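(* Let $E\subset c_0$ be a closed infinite-dimensional subspace of the Banach space $c_0$. Let $\varepsilon>0$. Then there exists an isomorphism $T\in\mathcal{L}(c_0)$ with $\|T-I_{c_0}\|<\varepsilon$ such that $T(E)$ is closed in the pointwise topology of $c_0$.
   Context: $c_0$ is the Banach space of real sequences converging to zero with the sup-norm. $\mathcal{L}(c_0)$ is the space of bounded linear operators from $c_0$ to $c_0$ with the operator norm, $I_{c_0}$ is the identity operator, and an isomorphism $T\in\mathcal{L}(c_0)$ is an invertible element (a linear homeomorphism of $c_0$ onto itself). The pointwise topology of $c_0$ is the topology inherited from the product $\mathbb{R}^{\mathbb{N}}$. *)

(* Defs.v *)
From HB Require Import structures.
From mathcomp Require Import all_boot all_order all_algebra.
From mathcomp Require Import all_classical all_reals all_analysis.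
Set Implicit Arguments.
Unset Strict Implicit.
Unset Printing Implicit Defensive.
Import Order.TTheory GRing.Theory Num.Theory.
Import numFieldNormedType.Exports.
Local Open Scope classical_set_scope.
Local Open Scope ring_scope.

Definition null_seq (R : realType) : {pred nat -> R} :=
  mem [set u : nat -> R | u @ \oo --> (0 : R)].

Record c0 (R : realType) := C0 {
  c0_seq :> nat -> R;
  c0P : c0_seq \in @null_seq R
}.

HB.instance Definition _ (R : realType) := [isSub for @c0_seq R].
HB.instance Definition _ (R : realType) := gen_eqMixin (c0 R).
HB.instance Definition _ (R : realType) := gen_choiceMixin (c0 R).

Lemma null_seq_submod_closed (R : realType) : submod_closed (@null_seq R).
Proof.
split=> [|a u v]; rewrite /null_seq !inE /=; first exact: cvg_cst.
move=> u0 v0; rewrite -[X in _ --> X](addr0 (0 : R)).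
by apply: cvgD => //; rewrite -(mulr0 a); apply: cvgM => //; exact: cvg_cst.
Qed.

HB.instance Definition _ (R : realType) :=
  GRing.isSubmodClosed.Build R (nat -> R) (@null_seq R)
    (@null_seq_submod_closed R).
HB.instance Definition _ (R : realType) :=
  [SubChoice_isSubLmodule of c0 R by <:].

Section c0_norm.
Variable R : realType.
Implicit Types x y : c0 R.

Definition c0_norm x : R := sup [set `|x n| | n in [set: nat]].

Lemma c0_has_sup x : has_sup [set `|x n| | n in [set: nat]].
Proof.
split; first by exists `|x 0%N|, 0%N.
have /set_mem/= x0 := c0P x.
have /cvg_seq_bounded [M [_ xM]] : cvgn x by apply/cvg_ex; exists 0.
by exists (M + 1) => _ [n _ <-]; apply: xM => //; rewrite ltrDl.
Qed.

Lemma c0_norm_ub x n : `|x n| <= c0_norm x.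
Proof. by apply: ub_le_sup; [case: (c0_has_sup x)|exists n]. Qed.

Lemma c0_norm_le x (M : R) : (forall n, `|x n| <= M) -> c0_norm x <= M.
Proof.
move=> xM; apply: ge_sup; first by case: (c0_has_sup x).
by move=> _ [n _ <-].
Qed.

Lemma c0_ler_normD x y : c0_norm (x + y) <= c0_norm x + c0_norm y.
Proof.
apply: c0_norm_le => n.
by rewrite (le_trans (ler_normD _ _))// lerD// c0_norm_ub.
Qed.

Lemma c0_normrZ (a : R) x : c0_norm (a *: x) = `|a| * c0_norm x.
Proof.
apply/le_anti/andP; split.
  by apply: c0_norm_le => n; rewrite normrM ler_wpM2l// c0_norm_ub.
have [->|a0] := eqVneq a 0.
  by rewrite normr0 mul0r (le_trans _ (c0_norm_ub _ 0%N)).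
rewrite -ler_pdivlMl ?normr_gt0//; apply: c0_norm_le => n.
by rewrite ler_pdivlMl ?normr_gt0// -normrM (c0_norm_ub (a *: x)).
Qed.

Lemma c0_normr0_eq0 x : c0_norm x = 0 -> x = 0.
Proof.
move=> x0; apply/val_inj/funext => n; apply/eqP.
by rewrite -normr_le0 -x0 c0_norm_ub.
Qed.

HB.instance Definition _ := Lmodule_isNormed.Build R (c0 R)
  c0_ler_normD c0_normrZ c0_normr0_eq0.

End c0_norm.

Definition c0_pointwise (R : realType) : Type :=
  initial_topology (@c0_seq R : c0 R -> {ptws nat -> R}).
HB.instance Definition _ (R : realType) := Topological.on (c0_pointwise R).

Definition pointwise_closed (R : realType) (A : set (c0 R)) : Prop :=
  closed (A : set (c0_pointwise R)).

Section normed_spaces.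
Variables (R : realType).

Definition finite_dimensional (V : lmodType R) (E : set V) : Prop :=
  exists (n : nat) (b : 'I_n -> V),
    E = [set \sum_(i < n) a i *: b i | a in [set: 'I_n -> R]].

Definition bounded_operator (V W : normedModType R) (f : V -> W) : Prop :=
  bounded_near f (nbhs (0 : V)).

(* Only meaningful for bounded linear f: [sup] is 0 on sets without an upper
   bound. *)
Definition operator_norm (V W : normedModType R) (f : V -> W) : R :=
  sup [set `|f x| | x in [set x : V | `|x| <= 1]].

Definition isomorphism (V W : normedModType R) (T : {linear V -> W}) : Prop :=
  bounded_operator T /\
  exists S : {linear W -> V},
    [/\ bounded_operator S, cancel T S & cancel S T].

End normed_spaces.

(* Main.v *)
From HB Require Import structures.
Require Import Defs.
From mathcomp Require Import all_boot all_order all_algebra.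
From mathcomp Require Import all_classical all_reals all_analysis.
From mathcomp Require Import lra.
Set Implicit Arguments.
Unset Strict Implicit.
Unset Printing Implicit Defensive.
Import Order.TTheory GRing.Theory Num.Theory.
Import numFieldNormedType.Exports.
Local Open Scope classical_set_scope.
Local Open Scope ring_scope.

(** A subspace of [c0] is closed for the pointwise topology as soon as it is an
    intersection of kernels of functionals that depend on finitely many
    coordinates. A norm closed subspace [E] is, by the Hahn-Banach theorem and the
    separability of [c0], the intersection of the kernels of a sequence of bounded
    functionals ([closed_subspace_kernels]). The idea is to find an operator
    [S = id + L] close to the identity such that each of these functionals,
    composed with [S], depends on finitely many coordinates; then [T = S^-1] works,
    because [T @` E] is the preimage of [E] under [S].

    The functionals are first replaced by functionals [h n] with the same common
    kernel that admit a biorthogonal sequence [x n] ([biorthogonalize]). A bounded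
    functional on [c0] is a norm limit of its composites with truncations
    ([c0_functional_tail]), as its dual norm is an l1 norm. The operator
      [L y = \sum_n h n (c0_trunc (N n) y - y) *: x n]
    is therefore as small as desired if the [N n] grow fast enough, and
    biorthogonality gives [h n (y + L y) = h n (c0_trunc (N n) y)]
    ([truncating_perturbation]). Invertibility of [id + L] follows from
    completeness of [c0] ([c0_complete], [invertible_perturbation]).

    The Hahn-Banach theorem is proved through minimal sublinear functionals
    ([mazur_orlicz]): Zorn's lemma is applied to functionals defined everywhere,
    so that no partial functional has to be extended. *)

(** * The Hahn-Banach theorem *)

Section mazur_orlicz.
Context {R : realType} {V : lmodType R}.
Implicit Types (p q : V -> R) (K : V -> R -> Prop).

Definition sublinear p :=
  (forall x y, p (x + y) <= p x + p y) /\
  (forall t x, 0 <= t -> p (t *: x) <= t * p x).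

(** A pair [(v, r)] of the cone stands for the constraint [r <= f v] on a
    functional [f] that is to be found. *)
Definition convex_cone K := [/\ K 0 0,
  forall v r w s, K v r -> K w s -> K (v + w) (r + s) &
  forall t v r, 0 <= t -> K v r -> K (t *: v) (t * r)].

Definition dominates p K := forall v r, K v r -> r <= p v.

(** The greatest sublinear functional [q <= p] such that [q (- v) <= - r] for
    every constraint [(v, r)]. A linear functional below it thus satisfies all
    the constraints. *)
Definition cone_inf p K x := inf [set p (x + a.1) - a.2 | a in [set a | K a.1 a.2]].

Lemma sublinear0 p : sublinear p -> p 0 = 0.
Proof.
move=> [pD pZ]; have := pD 0 0; have := pZ 0 0 (lexx 0).
by rewrite scale0r mul0r addr0 => *; lra.
Qed.

Lemma sublinear_geN p x : sublinear p -> - p (- x) <= p x.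
Proof.
move=> sp; have := sp.1 x (- x); rewrite subrr (sublinear0 sp) => *; lra.
Qed.

Section cone_inf_theory.
Context {p} {K}.
Hypotheses (sp : sublinear p) (cK : convex_cone K) (pK : dominates p K).

Lemma cone_inf_has_lbound x : has_lbound [set p (x + a.1) - a.2 | a in [set a | K a.1 a.2]].
Proof.
exists (- p (- x)) => _ [[v r] /= /pK rp <-].
by have := sp.1 (- x) (x + v); rewrite addKr => *; lra.
Qed.

Lemma cone_inf_le x v r : K v r -> cone_inf p K x <= p (x + v) - r.
Proof. by move=> Kv; apply: (ge_inf (cone_inf_has_lbound x)); exists (v, r). Qed.

Lemma cone_inf_ge x c : (forall v r, K v r -> c <= p (x + v) - r) -> c <= cone_inf p K x.
Proof.
move=> h; apply: lb_le_inf => [|_ [[v r] /= Kvr <-]]; last exact: h.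
by case: cK => K0 _ _; exists (p (x + 0) - 0), (0, 0).
Qed.

Lemma cone_inf_lep x : cone_inf p K x <= p x.
Proof. by case: cK => K0 _ _; rewrite (le_trans (cone_inf_le x K0))// addr0 subr0. Qed.

Lemma cone_infN v r : K v r -> cone_inf p K (- v) <= - r.
Proof.
by move=> Kv; rewrite (le_trans (cone_inf_le _ Kv))// addNr (sublinear0 sp) sub0r.
Qed.

Lemma cone_inf_sublinear : sublinear (cone_inf p K).
Proof.
case: (cK) => K0 KD KZ; split=> [x y|t x].
  rewrite -lerBlDr; apply: cone_inf_ge => v r Kv.
  rewrite lerBlDr -lerBlDl; apply: cone_inf_ge => w s Kw.
  have := cone_inf_le (x + y) (KD _ _ _ _ Kv Kw).
  by have := sp.1 (x + v) (y + w); rewrite addrACA => *; lra.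
rewrite le_eqVlt => /orP[/eqP<-|t0].
  rewrite scale0r mul0r (le_trans (cone_inf_lep 0))//.
  by rewrite (sublinear0 sp).
rewrite mulrC -ler_pdivrMr//; apply: cone_inf_ge => v r Kv.
rewrite ler_pdivrMr//; apply: (le_trans (cone_inf_le _ (KZ _ _ _ (ltW t0) Kv))).
by have := sp.2 _ (x + v) (ltW t0); rewrite scalerDr => *; lra.
Qed.

End cone_inf_theory.

(** Zorn's lemma applies because the pointwise infimum of a chain of sublinear
    functionals is sublinear: of two members of the chain, the smaller one
    serves for both summands in the triangle inequality. The infimum is finite
    since [- p (- x) <= q x] for each sublinear [q <= p]. *)
Lemma minimal_sublinear p : sublinear p -> exists q,
  [/\ sublinear q, forall x, q x <= p x &
      forall q', sublinear q' -> (forall x, q' x <= q x) -> q' = q].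
Proof.
move=> sp; pose T := {q | sublinear q /\ forall x, q x <= p x}.
pose le_T (s t : T) : bool := `[< forall x, sval t x <= sval s x >].
have [|r s t|s t|A Atot|t tmin] := @Zorn T le_T.
- by move=> t; apply/asboolP.
- by move=> /asboolP rs /asboolP st; apply/asboolP => x; exact: le_trans (rs x).
- case: s t => [s sP] [t tP] /asboolP/= st /asboolP/= ts.
  apply/eq_exist/funext => x; apply/le_anti.
  by rewrite st ts.
- have [->|/set0P[a Aa]] := eqVneq A set0.
    by exists (exist _ p (conj sp (fun x => lexx _))).
  pose B x := [set sval t x | t in A].
  have B0 x : B x !=set0 by exists (sval a x), a.
  have Blb x : has_lbound (B x).
    exists (- p (- x)) => _ [[q [sq qp]] _ <-] /=.
    by rewrite (le_trans _ (sublinear_geN x sq))// lerN2.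
  have Ble t x : A t -> inf (B x) <= sval t x.
    by move=> At; apply: (ge_inf (Blb x)); exists t.
  have sI : sublinear (fun x => inf (B x)).
    split=> [x y|t x].
      rewrite -lerBlDr; apply: lb_le_inf => // _ [s As <-].
      rewrite lerBlDr -lerBlDl; apply: lb_le_inf => // _ [t At <-].
      rewrite lerBlDl.
      have [/asboolP ts|/asboolP st] := Atot _ _ As At.
        rewrite (le_trans (Ble _ _ At))// (le_trans ((svalP t).1.1 x y))//.
        by rewrite lerD2r.
      rewrite (le_trans (Ble _ _ As))// (le_trans ((svalP s).1.1 x y))//.
      by rewrite lerD2l.
    rewrite le_eqVlt => /orP[/eqP<-|t0].
      rewrite scale0r mul0r (le_trans (Ble _ _ Aa))//.
      by rewrite (sublinear0 (svalP a).1).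
    rewrite mulrC -ler_pdivrMr//; apply: lb_le_inf => // _ [s As <-].
    rewrite ler_pdivrMr// (le_trans (Ble _ _ As))// mulrC.
    exact: ((svalP s).1.2 _ _ (ltW t0)).
  have Ip x : inf (B x) <= p x by rewrite (le_trans (Ble _ _ Aa))// (svalP a).2.
  pose t : T := exist _ (fun x => inf (B x)) (conj sI Ip).
  by exists t => s As; apply/asboolP => x; exact: Ble.
- exists (sval t); have [st tp] := svalP t; split=> // q' sq' q't.
  have q'p x : q' x <= p x by exact: le_trans (q't x) (tp x).
  by rewrite -(tmin (exist _ q' (conj sq' q'p)))//; apply/asboolP.
Qed.

(** Imposing on [q] the constraint [q x <= f x], that is, replacing [q] by its
    infimum over the ray of [(x, q x)], does not change a minimal [q]. Hence
    [q (- x) <= - q x], which upgrades both sublinearity inequalities to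
    equalities. *)
Lemma minimal_sublinear_linear q : sublinear q ->
  (forall q', sublinear q' -> (forall x, q' x <= q x) -> q' = q) ->
  linear (q : V -> R^o).
Proof.
move=> sq qmin.
have qN x : q (- x) = - q x.
  pose K v r := exists2 t, 0 <= t & v = t *: x /\ r = t * q x.
  have cK : convex_cone K.
    split=> [|_ _ _ _ [t t0 [-> ->]] [s s0 [-> ->]]|s _ _ s0 [t t0 [-> ->]]].
    - by exists 0; rewrite // scale0r mul0r.
    - by exists (t + s); rewrite ?addr_ge0// scalerDl mulrDl.
    - by exists (s * t); rewrite ?mulr_ge0// scalerA mulrA.
  have qK : dominates q K.
    move=> _ _ [t + [-> ->]]; rewrite le_eqVlt => /orP[/eqP<-|t0].
      by rewrite scale0r mul0r sublinear0.
    have := sq.2 t^-1 (t *: x); rewrite invr_ge0 scalerK ?gt_eqF// => /(_ (ltW t0)).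
    by rewrite -ler_pdivrMl ?invr_gt0// invrK.
  have Kx : K x (q x) by exists 1; rewrite // scale1r mul1r.
  have := cone_infN sq qK Kx.
  rewrite (qmin _ (cone_inf_sublinear sq cK qK) (cone_inf_lep sq cK qK)) => qNx.
  by have := sublinear_geN x sq => *; lra.
have qZ t x : 0 <= t -> q (t *: x) = t * q x.
  move=> t0; apply/le_anti; rewrite sq.2//=.
  by have := sq.2 t (- x) t0; rewrite scalerN !qN mulrN lerN2.
have qD x y : q (x + y) = q x + q y.
  apply/le_anti; rewrite sq.1//=.
  by have := sq.1 (- x) (- y); rewrite -opprD !qN -opprD lerN2.
move=> t x y; rewrite qD; congr (_ + _).
have [/qZ->//|/ltW t0] := leP 0 t.
by rewrite -[t]opprK scaleNr qN qZ ?oppr_ge0// scaleNr.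
Qed.

(** This form of the Hahn-Banach theorem contains at once the extension of a
    functional given on a line and its vanishing on a subspace: both are
    constraints indexed by a convex cone. *)
Lemma mazur_orlicz p K : sublinear p -> convex_cone K -> dominates p K ->
  exists f : {scalar V},
    (forall x, f x <= p x) /\ (forall v r, K v r -> r <= f v).
Proof.
move=> sp cK pK.
have [q [sq qp qmin]] := minimal_sublinear (cone_inf_sublinear sp cK pK).
pose qL := GRing.isLinear.Build R V R^o *%R q (minimal_sublinear_linear sq qmin).
pose f : {scalar V} := HB.pack q qL.
exists f; split=> [x|v r Kv].
  by rewrite (le_trans (qp x))// cone_inf_lep.
by rewrite -lerN2 -(linearN f) (le_trans (qp _))// (cone_infN sp).
Qed.

End mazur_orlicz.

(** * Closed subspaces of separable normed spaces *)

Section separation.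
Context {R : realType} {V : normedModType R}.

(** The constraints are [t * dist (d, E) <= f (e + t *: d)] for [e] in [E] and
    [0 <= t]; the norm dominates them by definition of the distance. Those with
    [t = 0] force [f] to vanish on [E], which contains [- e] with [e]. *)
Lemma functional_of_distance (E : set V) (d : V) : submod_closed (mem E) ->
  exists f : {scalar V}, [/\ forall x, `|f x| <= `|x|,
    forall e, E e -> f e = 0 &
    inf [set `|d - e| | e in E] <= f d].
Proof.
move=> [E0 Elin]; set dist := inf _.
have {}E0 : E 0 by rewrite inE in E0.
have {}Elin a u v : E u -> E v -> E (a *: u + v).
  by move=> Eu Ev; have := Elin a u v; rewrite !inE; apply.
have EZ a u : E u -> E (a *: u) by move=> Eu; rewrite -[_ *: _]addr0; exact: Elin.
have ED u v : E u -> E v -> E (u + v).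
  by move=> Eu Ev; rewrite -[u]scale1r; exact: Elin.
have dist_le e : E e -> dist <= `|d - e|.
  by move=> Ee; apply: ge_inf; [exists 0 => _ [? _ <-]|exists e].
pose K v r := exists2 t, 0 <= t & E (v - t *: d) /\ r = t * dist.
have cK : convex_cone K.
  split=> [|v _ w _ [t t0 [Ev ->]] [s s0 [Ew ->]]|s v _ s0 [t t0 [Ev ->]]].
  - by exists 0; rewrite // scale0r subr0 mul0r.
  - exists (t + s); first exact: addr_ge0.
    by rewrite mulrDl scalerDl opprD addrACA; split=> //; exact: ED.
  - exists (s * t); first exact: mulr_ge0.
    by rewrite mulrA -scalerA -scalerBr; split=> //; exact: EZ.
have KN : dominates (fun v : V => `|v|) K.
  move=> v _ [t + [Ev ->]]; rewrite le_eqVlt => /orP[/eqP<-|t0].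
    by rewrite mul0r.
  have := dist_le _ (EZ (- t^-1) _ Ev).
  rewrite scaleNr opprK scalerBr scalerK ?gt_eqF// subrKC normrZ.
  by rewrite gtr0_norm ?invr_gt0// ler_pdivlMl.
have sN : sublinear (fun v : V => `|v|).
  split=> [x y|t x t0]; first exact: ler_normD.
  by rewrite normrZ ger0_norm.
have [f [fN fK]] := mazur_orlicz sN cK KN.
have fE e : E e -> 0 <= f e.
  by move=> Ee; apply: fK; exists 0; rewrite // scale0r subr0 mul0r.
exists f; split=> [x|e Ee|].
- by rewrite ler_norml fN andbT lerNl -linearN -normrN fN.
- apply/le_anti; rewrite fE// andbT -oppr_ge0 -linearN fE//.
  by rewrite -scaleN1r; exact: EZ.
- by apply: fK; exists 1; rewrite // scale1r subrr mul1r.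
Qed.

(** Let [f k] vanish on [E] and satisfy [dist (d k, E) <= f k (d k)]. If the ball
    of center [x] and radius [e] misses [E] and [d k] is within [e / 3] of [x],
    then [2 * e / 3 <= f k (d k)], and so [f k x] is positive. *)
Lemma closed_subspace_kernels (E : set V) (d : nat -> V) :
    submod_closed (mem E) -> closed E ->
    (forall x e, 0 < e -> exists k, `|x - d k| < e) ->
  exists f : nat -> {scalar V}, (forall k x, `|f k x| <= `|x|) /\
    forall x, E x <-> forall k, f k x = 0.
Proof.
move=> sE cE dd.
have /choice[f fP] := fun k => functional_of_distance (d k) sE.
exists f; split=> [k x|x]; first by have [] := fP k.
split=> [Ex k|fx]; first by have [_ /(_ x Ex)] := fP k.
apply: contrapT => nEx.
have /nbhs_ballP[e /= e0 eE] : nbhs x (~` E).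
  by apply: open_nbhs_nbhs; split=> //; exact: closed_openC.
have [k xk] := dd x _ (divr_gt0 e0 (ltr0Sn R 2)).
have [fN _ fd] := fP k.
have : 2 * e / 3 <= inf [set `|d k - e| | e in E].
  apply: lb_le_inf.
    have [E0 _] := sE; rewrite inE in E0.
    by exists `|d k - 0|, 0.
  move=> _ [y Ey <-]; rewrite leNgt; apply/negP => dy.
  apply: (eE y) => //; rewrite -ball_normE /=.
  by have := ler_distD (d k) x y => *; lra.
have := fN (d k - x); rewrite linearB/= fx subr0 distrC => ?.
by have := ler_norm (f k (d k)) => *; lra.
Qed.

(** A Gram-Schmidt process. If [f n] does not vanish on the common kernel of its
    predecessors, let [x n] in that kernel satisfy [f n (x n) = 1], and otherwise
    let [x n = 0]. Subtracting successively the components along the [x m] gives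
    projections [P n] onto the common kernel of [f 0 .. f n.-1], and
    [h n = f n \o P n]. The last property is a division-free way to say that
    [h n (x n) = 1] unless [h n = 0]. *)
Lemma biorthogonalize (f : nat -> {scalar V}) :
    (forall n, exists C : R, forall y, `|f n y| <= C * `|y|) ->
  exists (h : nat -> {scalar V}) (x : nat -> V),
  [/\ forall n, exists C : R, forall y, `|h n y| <= C * `|y|,
      forall y, (forall n, h n y = 0) <-> (forall n, f n y = 0),
      forall n m, n != m -> h n (x m) = 0 &
      forall n y, h n (x n) * h n y = h n y].
Proof.
move=> bf.
have /choice[x xP] n : exists x : V, (forall m, (m < n)%N -> f m x = 0) /\
    (f n x = 1 \/ x = 0 /\ forall y, (forall m, (m < n)%N -> f m y = 0) -> f n y = 0).
  have [[y [fmy fny]]|no] := pselect (exists y, (forall m, (m < n)%N -> f m y = 0) /\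
    f n y <> 0); last first.
    exists 0; split=> [m _|]; first by rewrite linear0.
    right; split=> // y ym; apply: contrapT => fny.
    by apply: no; exists y.
  exists ((f n y)^-1 *: y); split=> [m mn|].
    by rewrite linearZ /= (fmy _ mn) mulr0.
  by left; rewrite linearZ/= mulVf//; apply/eqP.
pose P := fix P n y : V := if n is m.+1 then P m y - f m (P m y) *: x m else y.
have Plin n : linear (P n).
  elim: n => [|n IH] a y z //=; rewrite IH linearP scalerDl -scalerA opprD.
  by rewrite addrACA scalerBr.
have Pid n y : (forall m, (m < n)%N -> f m y = 0) -> P n y = y.
  elim: n => //= n IH fy; rewrite IH => [|m mn]; last by rewrite fy// ltnW.
  by rewrite fy// scale0r subr0.
(* When [x n = 0], [f n] already vanishes on the range of [P n], so that the
   subtracted component is null. *)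
have fP0 n m y : (m < n)%N -> f m (P n y) = 0.
  elim: n m => //= n IH m; rewrite ltnS leq_eqVlt linearB linearZ/= => /orP[/eqP->|mn].
    have [_ [->|[_ fn]]] := xP n; first by rewrite mulr1 subrr.
    by rewrite (fn (P n y))// mul0r subr0.
  by rewrite (IH _ mn) (xP n).1// mulr0 subrr.
have hlin n : linear ((fun y => f n (P n y)) : V -> R^o).
  by move=> a y z; rewrite Plin linearP.
pose h n : {scalar V} := HB.pack (fun y => f n (P n y))
  (GRing.isLinear.Build R V R^o *%R _ (hlin n)).
exists h, x; split=> [n|y|n m nm|n y]; rewrite /h/=.
- have [C PC] : exists C, forall y, `|P n y| <= C * `|y|.
    elim: n => [|n [C IH]] /=; first by exists 1 => y; rewrite mul1r.
    have [D fD] := bf n.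
    exists (C + `|D| * `|C| * `|x n|) => y.
    rewrite (le_trans (ler_normB _ _))// mulrDl lerD//.
    rewrite normrZ mulrAC ler_wpM2r// (le_trans (fD _))//.
    rewrite (le_trans (ler_wpM2r (normr_ge0 _) (ler_norm D)))//.
    rewrite -mulrA ler_wpM2l// (le_trans (IH _))// ler_wpM2r//.
    exact: ler_norm.
  have [D fD] := bf n; exists (`|D| * C) => y.
  rewrite (le_trans (fD _))//.
  rewrite (le_trans (ler_wpM2r (normr_ge0 _) (ler_norm D)))//.
  by rewrite -mulrA ler_wpM2l.
- split=> [hy|fy] n; last by rewrite Pid// fy.
  suff Py m : P m y = y by rewrite -{1}(Py n) hy.
  by elim: m => //= m IH; rewrite hy scale0r subr0.
- have [mn|nm'] := ltnP m n; last first.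
    (* [m > n]: [x m] is in the kernel of [f 0 .. f m.-1], thus fixed by [P n]. *)
    rewrite Pid; first by apply: (xP m).1; rewrite ltn_neqAle nm.
    by move=> k kn; apply: (xP m).1; exact: leq_trans kn nm'.
  (* [m < n]: [x m] is fixed by [P m] and killed by [P m.+1]. *)
  suff -> : P n (x m) = 0 by rewrite linear0.
  elim: n mn {nm} => //= n IH; rewrite ltnS leq_eqVlt => /orP[/eqP<-|mn]; last first.
    by rewrite IH// linear0 scale0r subr0.
  rewrite Pid; last exact: (xP m).1.
  have [_ [->|[-> _]]] := xP m; first by rewrite scale1r subrr.
  by rewrite scaler0 subr0.
- have [xn [f1|[_ fn]]] := xP n; first by rewrite Pid// f1 mul1r.
  rewrite (fn (P n y)) ?mulr0// => m mn; exact: fP0.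
Qed.

End separation.

(** * Small perturbations of the identity of a Banach space *)

Lemma bounded_scalar_lim (R : realType) (V : normedModType R) (h : {scalar V})
    (C : R) (u : nat -> V) (l : V) (c : R) :
    (forall y, `|h y| <= C * `|y|) -> u @ \oo --> l ->
    (exists N, forall n, (N <= n)%N -> h (u n) = c) -> h l = c.
Proof.
move=> hC ul [N uN]; apply/eqP; rewrite -subr_eq0 -normr_le0.
apply/ler_addgt0Pr => e e0; rewrite add0r.
have D0 : 0 < `|C| + 1 by rewrite ltr_wpDl.
have /cvgrPdist_le/(_ _ (divr_gt0 e0 D0))[M _ uM] := ul.
rewrite -(uN (maxn N M)) ?leq_maxl// -linearB (le_trans (hC _))//.
rewrite (@le_trans _ _ ((`|C| + 1) * `|l - u (maxn N M)|))//.
  by rewrite ler_wpM2r// (le_trans (ler_norm C))// lerDl.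
by rewrite -ler_pdivlMl// mulrC uM//= leq_maxr.
Qed.

Section perturbation.
Context {R : realType} {V : completeNormedModType R}.

(** The series converges in norm, with the geometric majorant
    [d * `|y| / 2 ^ n.+1], whose sum is [d * `|y|]. *)
Lemma nuclear_operator (g : nat -> {scalar V}) (x : nat -> V) (d : R) :
    (forall n y, `|g n y| * `|x n| <= d / (2 ^ n.+1)%:R * `|y|) ->
  exists L : {linear V -> V}, (forall y, `|L y| <= d * `|y|) /\
    forall y, series (fun n => g n y *: x n) @ \oo --> L y.
Proof.
move=> gx; pose u y n := g n y *: x n.
pose v (y : V) k := d * `|y| / (2 ^ (k + 1))%:R.
have uv y n : `|u y n| <= v y n.
  by rewrite /u /v normrZ addn1 mulrAC.
have vE y : series (v y) @ \oo --> d * `|y|.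
  by have := cvg_geometric_series_half (d * `|y|) 0; rewrite expr0 divr1.
have cNu y : cvgn [normed series (u y)].
  apply: series_le_cvg (cvgP _ (vE y)) => n //=.
  exact: le_trans (uv y n).
have cu y := normed_cvg (cNu y).
have Llin : linear (fun y => limn (series (u y))).
  move=> a y z; apply: cvg_lim => //.
  have -> : series (u (a *: y + z)) =
      fun n => a *: series (u y) n + series (u z) n.
    apply/funext => n; rewrite /series/= scaler_sumr -big_split/=.
    by apply: eq_bigr => i _; rewrite /u linearP scalerDl scalerA.
  by apply: cvgD; [apply: cvgZ; [exact: cvg_cst|exact: cu]|exact: cu].
pose L : {linear V -> V} := HB.pack (fun y => limn (series (u y)))
  (GRing.isLinear.Build R V V *:%R _ Llin).
exists L; split=> y; last exact: cu.
rewrite (le_trans (lim_series_norm (cNu y)))//.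
rewrite -(cvg_lim _ (vE y))//; apply: lim_series_le.
- exact: cNu.
- exact: cvgP (vE y).
- exact: uv.
Qed.

(** [y + L y = z] says that [y] is a fixed point of the contraction
    [y |-> z - L y]; injectivity and the bound on the inverse come from
    [(1 - q) * `|y| <= `|y + L y|]. *)
Lemma invertible_perturbation (L : {linear V -> V}) (q : R) :
    0 <= q < 1 -> (forall y, `|L y| <= q * `|y|) ->
  exists T : {linear V -> V}, [/\ cancel (fun y => y + L y) T,
    cancel T (fun y => y + L y) & forall y, `|T y| <= (1 - q)^-1 * `|y|].
Proof.
move=> /andP[q0 q1] Lq; pose S y := y + L y.
have SN y : (1 - q) * `|y| <= `|S y|.
  have := Lq y; have := ler_normB (S y) (L y).
  by rewrite /S addrK => *; lra.
have SB y z : S (y - z) = S y - S z.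
  by rewrite /S linearB opprD addrACA.
have Sinj y z : S y = S z -> y = z.
  move=> yz; apply/eqP; rewrite -subr_eq0 -normr_le0.
  have := SN (y - z); rewrite SB yz subrr normr0 pmulr_rle0//.
  by rewrite subr_gt0.
have /choice[T ST] z : exists y, S y = z.
  pose f : {fun [set: V] >-> [set: V]} := totalfun (fun y => z - L y).
  have [|||p _ pE] := @banach_fixed_point R V setT f.
  - exists (NngNum q0); split=> // -[y y'] _ /=.
    rewrite /f /totalfun /totalfun_ opprB addrC addrA subrK -linearB.
    by rewrite -[y - y']opprB normrN.
  - exact: closedT.
  - by exists 0.
  - by exists p; rewrite /S {1}pE /f /totalfun /totalfun_ subrK.
have Tlin : linear T.
  move=> a y z; apply: Sinj; rewrite ST {1}/S linearP.
  by rewrite addrACA -scalerDr -/(S _) -/(S _) !ST.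
pose TL : {linear V -> V} := HB.pack T (GRing.isLinear.Build R V V *:%R T Tlin).
exists TL; split=> y; [apply: Sinj; exact: ST|exact: ST|].
by rewrite ler_pdivlMl ?subr_gt0// -{2}[y]ST.
Qed.

End perturbation.

(** * The space of null sequences *)

Section c0_space.
Context {R : realType}.
Implicit Types (x y : c0 R) (u : nat -> R).

Lemma null_seq_near (u : nat -> R) : u \in @null_seq R <->
  forall e, 0 < e -> exists N, forall n, (N <= n)%N -> `|u n| <= e.
Proof.
rewrite /null_seq inE/=; split.
  move=> /cvgr0_norm_le u0 e /u0[N _ uN]; exists N => n; exact: uN.
move=> u0; apply/cvgr0Pnorm_le => e /u0[N uN].
by exists N => // n /=; exact: uN.
Qed.

Lemma c0_dist_ub x y n : `|x n - y n| <= `|x - y|.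
Proof. exact: (c0_norm_ub (x - y)). Qed.

(** A Cauchy filter converges at each coordinate, and uniformly in the coordinate,
    so that the limit inherits convergence to zero. *)
Lemma c0_complete (F : set_system (c0 R)) :
  ProperFilter F -> cauchy F -> cvg F.
Proof.
move=> FF Fcauchy; have /cauchy_ballP Fc := Fcauchy.
have cvF n : cvg ((fun x : c0 R => x n) @ F).
  apply/cauchy_cvgP/cauchy_exP => e e0.
  have /cauchyP/(_ e e0)[x Fx] := Fcauchy; exists (x n).
  suff : F [set y | ball (x n) e (y n)] by [].
  apply: filterS Fx => y; rewrite /= -!ball_normE /=.
  exact/le_lt_trans/c0_dist_ub.
pose l n : R := lim ((fun x : c0 R => x n) @ F).
have lF (e : R) : 0 < e -> \forall x \near F, forall n, `|l n - (x : c0 R) n| <= e.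
  move=> e0; have e20 : 0 < e / 2 by rewrite divr_gt0.
  near=> x => n; near F => y.
  rewrite (le_trans (ler_distD (y n) _ _))// (splitr e) lerD//.
    by near: y; have /cvgrPdist_le := cvF n; apply.
  rewrite distrC (le_trans (c0_dist_ub x y n))// ltW//.
  have : ball x (e / 2) y by near: y; near: x; apply: nearP_dep; exact: Fc.
  by rewrite -ball_normE.
have lnull : l \in @null_seq R.
  apply/null_seq_near => e e0; have e20 : 0 < e / 2 by rewrite divr_gt0.
  near F => x.
  have [N xN] := (null_seq_near x).1 (c0P x) _ e20.
  exists N => n /xN xn; rewrite -(subrK (x n) (l n)) (le_trans (ler_normD _ _))//.
  rewrite (splitr e) lerD//.
  by move: n {xn}; near: x; exact: lF.
apply/cvg_ex; exists (C0 lnull); apply/cvgrPdist_le => e e0.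
by near=> x; apply: c0_norm_le; near: x; exact: lF.
Unshelve. all: by end_near. Qed.

HB.instance Definition _ := Uniform_isComplete.Build (c0 R) c0_complete.

Lemma trunc_null N u : (fun n => if (n < N)%N then u n else 0) \in @null_seq R.
Proof.
apply/null_seq_near => e e0; exists N => n nN.
by rewrite ltnNge nN /= normr0 ltW.
Qed.

(** The argument is an arbitrary sequence, so that every finitely supported vector
    has this form; [c0_trunc] is the corresponding linear projection of [c0]. *)
Definition c0_cut N u : c0 R := C0 (trunc_null N u).

Definition c0_trunc N x : c0 R := c0_cut N x.

Lemma c0_trunc_linear N : linear (c0_trunc N).
Proof.
move=> a x y; apply/val_inj/funext => n.
change ((if (n < N)%N then a * x n + y n else 0) =
  a * (if (n < N)%N then x n else 0) + (if (n < N)%N then y n else 0)).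
by case: ifP; rewrite // mulr0 addr0.
Qed.

HB.instance Definition _ N :=
  GRing.isLinear.Build R (c0 R) (c0 R) *:%R (c0_trunc N) (c0_trunc_linear N).

Lemma c0_trunc_near x e : 0 < e -> exists N, `|x - c0_trunc N x| <= e.
Proof.
move=> e0; have [N xN] := (null_seq_near x).1 (c0P x) _ e0.
exists N; apply: c0_norm_le => n.
change (`|x n - (if (n < N)%N then x n else 0)| <= e).
by case: ltnP => [_|/xN]; rewrite ?subrr ?normr0 ?subr0// ltW.
Qed.

(** Finitely supported rational sequences, enumerated through [unpickle]. *)
Lemma c0_separable : exists d : nat -> c0 R,
  forall x e, 0 < e -> exists k, `|x - d k| < e.
Proof.
pose d (s : seq rat) := c0_cut (size s) (fun n => ratr s`_n).
exists (fun k => d (odflt [::] (unpickle k))) => x e e0.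
have e20 : 0 < e / 2 by rewrite divr_gt0.
have [N xN] := (null_seq_near x).1 (c0P x) _ e20.
have /choice[q qP] n : exists q : rat, `|x n - ratr q| <= e / 2.
  have [|q] := @rat_in_itvoo R (x n - e / 2) (x n + e / 2); first by lra.
  by rewrite in_itv/= => /andP[? ?]; exists q; rewrite ler_norml; lra.
exists (pickle (mkseq q N)); rewrite pickleK/=.
apply: (@le_lt_trans _ _ (e / 2)); last by lra.
apply: c0_norm_le => n; rewrite /d size_mkseq.
change (`|x n - (if (n < N)%N then ratr (mkseq q N)`_n else 0)| <= e / 2).
by case: ltnP => [nN|/xN]; rewrite ?nth_mkseq// subr0.
Qed.

(** This is the absolute convergence of the series of [f] on the unit vectors,
    obtained without writing the series. Choose [y] in the unit ball almost
    maximizing [f]; up to a small error, [y] is supported in [0, N[. If [z] in the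
    unit ball vanishes on [0, N[, then [y + z] and [y - z] are still in the unit
    ball, so neither [f z] nor [- f z] can be larger than the gap between [f y]
    and the supremum. *)
Lemma c0_functional_tail (f : {scalar c0 R}) (C : R) :
    (forall x, `|f x| <= C * `|x|) ->
  forall e, 0 < e -> exists N, forall x, `|f (c0_trunc N x - x)| <= e * `|x|.
Proof.
move=> fC e e0; pose D := `|C| + 1.
have D0 : 0 < D by rewrite /D ltr_wpDl.
have fD x : `|f x| <= D * `|x|.
  rewrite (le_trans (fC x))// ler_wpM2r// /D (le_trans (ler_norm C))//.
  by rewrite lerDl.
pose A := [set f x | x in [set x | `|x| <= 1]].
have supA : has_sup A.
  split; first by exists (f 0), 0; rewrite //= normr0.
  exists D => _ [x /= x1 <-]; rewrite (le_trans (ler_norm _))//.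
  by rewrite (le_trans (fD x))// ler_piMr// ltW.
have [_ [y /= y1 <-] fy] : exists2 r, A r & sup A - e / 2 < r.
  by apply: sup_adherent => //; rewrite divr_gt0.
have [N yN] : exists N, `|y - c0_trunc N y| <= e / 2 / D.
  by apply: c0_trunc_near; rewrite !divr_gt0.
have fyN : sup A - e < f (c0_trunc N y).
  have := fD (y - c0_trunc N y); have := ler_norm (f (y - c0_trunc N y)).
  rewrite linearB/=; have : D * `|y - c0_trunc N y| <= e / 2.
    by rewrite -ler_pdivlMl// mulrC.
  by lra.
have le1 x : `|x| <= 1 -> f (c0_trunc N x - x) <= e.
  move=> x1; have : f (c0_trunc N y + (c0_trunc N x - x)) <= sup A.
    apply: ub_le_sup; [exact: supA.2|eexists; last by []].
    apply: c0_norm_le => n.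
    change (`|(if (n < N)%N then y n else 0) +
      ((if (n < N)%N then x n else 0) - x n)| <= 1).
    case: ltnP => _.
      by rewrite subrr addr0 (le_trans (c0_norm_ub y n)).
    by rewrite !add0r normrN (le_trans (c0_norm_ub x n)).
  by rewrite linearD/=; lra.
exists N => x; have [->|x0] := eqVneq x 0.
  by rewrite linear0 subrr linear0 !normr0 mulr0.
rewrite -ler_pdivrMr ?normr_gt0//.
pose z := `|x|^-1 *: x.
have z1 : `|z| <= 1 by rewrite normrZ normfV normr_id mulVf ?normr_eq0.
have -> : `|f (c0_trunc N x - x)| / `|x| = `|f (c0_trunc N z - z)|.
  by rewrite /z linearZ/= -scalerBr linearZ/= normrM normfV normr_id mulrC.
rewrite ler_norml le1// andbT lerNl -linearN/= opprB addrC.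
by have := le1 (- z); rewrite normrN linearN/= opprK addrC; exact.
Qed.

(** [f \o c0_trunc N] is a linear combination of the first [N] coordinates:
    passing from [N] to [N.+1] adds a multiple of the [N]-th one. *)
Lemma pointwise_continuous_trunc (f : {scalar c0 R}) N :
  continuous (fun y : c0_pointwise R => f (c0_trunc N (y : c0 R)) : R).
Proof.
have coord n : continuous (fun y : c0_pointwise R => (y : c0 R) n).
  move=> y; apply: (@continuous_comp (c0_pointwise R) {ptws nat -> R} R
    (@c0_seq R) (fun u => u n)).
    exact: initial_continuous.
  exact: proj_continuous.
elim: N => [|N IH].
  have -> : (fun y : c0_pointwise R => f (c0_trunc 0 (y : c0 R)) : R) = fun=> 0.
    apply/funext => y; rewrite (_ : c0_trunc 0 _ = 0) ?linear0//.
    exact/val_inj/funext.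
  exact: (@cst_continuous (c0_pointwise R) R 0).
pose e := c0_cut N.+1 (fun n => (n == N)%:R).
have -> : (fun y : c0_pointwise R => f (c0_trunc N.+1 (y : c0 R)) : R) =
    fun y : c0_pointwise R => (y : c0 R) N * f e + f (c0_trunc N (y : c0 R)).
  apply/funext => y.
  suff -> : c0_trunc N.+1 (y : c0 R) =
      (y : c0 R) N *: e + c0_trunc N (y : c0 R) by rewrite linearP.
  apply/val_inj/funext => n.
  change ((if (n < N.+1)%N then (y : c0 R) n else 0) =
    (y : c0 R) N * (if (n < N.+1)%N then (n == N)%:R else 0) +
    (if (n < N)%N then (y : c0 R) n else 0)).
  by rewrite ltnS; case: ltngtP => [| |->]; rewrite ?(mulr0, addr0, mulr1, add0r).
move=> y; apply: (@cvgD _ _ _ (nbhs y) _ (fun z : c0_pointwise R =>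
  (z : c0 R) N * f e) (fun z : c0_pointwise R => f (c0_trunc N (z : c0 R)))).
  apply: (@cvgM _ _ (nbhs y) _ (fun z : c0_pointwise R => (z : c0 R) N)
    (fun=> f e)); first exact: coord.
  exact: (@cst_continuous (c0_pointwise R) R).
exact: IH.
Qed.

Lemma pointwise_closed_trunc (f : {scalar c0 R}) N :
  pointwise_closed [set y | f (c0_trunc N y) = 0].
Proof.
have /continuous_closedP/(_ _ (@closed_eq R 0)) :=
  @pointwise_continuous_trunc f N.
exact.
Qed.

End c0_space.

(** * Making functionals depend on finitely many coordinates *)

Section truncating_perturbation.
Context {R : realType}.

(** [L] is the sum of the rank one operators
    [y |-> h n (c0_trunc (N n) y - y) *: x n]. By biorthogonality, [h n] only sees
    the [n]-th one, and so [h n (L y)] is exactly the correction that turns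
    [h n y] into [h n (c0_trunc (N n) y)]. The [N n] are taken large enough for
    [L] to be small, whatever the norms of the [x n]. *)
Lemma truncating_perturbation (h : nat -> {scalar c0 R}) (x : nat -> c0 R) (d : R) :
    0 < d -> (forall n, exists C : R, forall y, `|h n y| <= C * `|y|) ->
    (forall n m, n != m -> h n (x m) = 0) ->
    (forall n y, h n (x n) * h n y = h n y) ->
  exists (L : {linear c0 R -> c0 R}) (N : nat -> nat),
    (forall y, `|L y| <= d * `|y|) /\
    (forall n y, h n (y + L y) = h n (c0_trunc (N n) y)).
Proof.
move=> d0 hb hx0 hx1.
have /choice[N NP] n : exists N, forall y,
    `|h n (c0_trunc N y - y)| <= d / (2 ^ n.+1)%:R / (`|x n| + 1) * `|y|.
  have [C hC] := hb n; apply: c0_functional_tail hC _ _.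
  by rewrite !divr_gt0 ?ltr0n ?expn_gt0// ltr_wpDl.
have glin n : linear ((fun y => h n (c0_trunc (N n) y - y)) : c0 R -> R^o).
  move=> a y z; rewrite -linearP; congr (h n _).
  by rewrite [c0_trunc _ _]linearP opprD addrACA scalerBr.
pose g n : {scalar c0 R} := HB.pack (fun y => h n (c0_trunc (N n) y - y))
  (GRing.isLinear.Build R (c0 R) R^o *%R _ (glin n)).
have [L [Ld Lg]] : exists L : {linear c0 R -> c0 R},
    (forall y, `|L y| <= d * `|y|) /\
    forall y, series (fun n => g n y *: x n) @ \oo --> L y.
  apply: nuclear_operator => n y.
  have x1 : 0 < `|x n| + 1 by rewrite ltr_wpDl.
  rewrite (@le_trans _ _ (`|g n y| * (`|x n| + 1)))//.
    by rewrite ler_wpM2l// lerDl.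
  rewrite -ler_pdivlMr// (le_trans (NP n y))//.
  by rewrite mulrAC.
exists L, N; split=> // n y.
suff hL : h n (L y) = h n (c0_trunc (N n) y - y).
  by rewrite linearD/= hL linearB/= subrKC.
have [C hC] := hb n; apply: bounded_scalar_lim hC (Lg y) _.
exists n.+1 => m nm; rewrite /series/= linear_sum/= big_mkord.
rewrite (bigD1 (Ordinal nm))//= big1 ?addr0 => [|i].
  by rewrite linearZ/= mulrC hx1.
by rewrite linearZ/= -val_eqE/= eq_sym => /hx0->; rewrite mulr0.
Qed.

End truncating_perturbation.

Theorem theorem13 (R : realType) (E : set (c0 R)) (eps : R)
    (E_subspace : submod_closed (mem E)) (E_closed : closed E)
    (E_infdim : ~ finite_dimensional E) (eps_gt0 : 0 < eps) :
  exists T : {linear c0 R -> c0 R},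
    [/\ isomorphism T,
        operator_norm (T \- idfun) < eps &
        pointwise_closed (T @` E)].
Proof.
have [d dd] := @c0_separable R.
have [f [f1 fE]] := closed_subspace_kernels E_subspace E_closed dd.
have [|h [x [hb hf hx0 hx1]]] := @biorthogonalize _ _ f.
  by move=> n; exists 1 => y; rewrite mul1r.
(* [q <= 1 / 2] gives [`|T| <= 2], and then [`|T - 1| = `|L \o T| <= 2 * q]. *)
pose q := Num.min 2^-1 (eps / 4).
have q0 : 0 < q by rewrite lt_min invr_gt0 ltr0n divr_gt0.
have q2 : q <= 2^-1 by rewrite ge_min lexx.
have q4 : q <= eps / 4 by rewrite ge_min lexx orbT.
have [L [N [Lq hL]]] := truncating_perturbation q0 hb hx0 hx1.
have [|T [ST TS Tq]] := invertible_perturbation (q := q) _ Lq.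
  by apply/andP; split; lra.
have T2 y : `|T y| <= 2 * `|y|.
  rewrite (le_trans (Tq y))// ler_wpM2r// -[leRHS]invrK lef_pV2 ?posrE//; lra.
exists T; split.
- split.
    apply/bounded_funP => r; exists (2 * r) => y yr.
    by apply: le_trans (T2 y) _; rewrite ler_wpM2l.
  exists (idfun \+ L); split=> //.
  apply/bounded_funP => r; exists (r + q * r) => y yr.
  apply: le_trans (ler_normD _ _) _; apply: lerD => //.
  apply: le_trans (Lq y) _.
  by rewrite ler_wpM2l// ltW.
- apply: (@le_lt_trans _ _ (eps / 2)); last by lra.
  apply: ge_sup; first by exists `|(T \- idfun) 0|, 0; rewrite //= normr0.
  move=> _ [y /= y1 <-].
  have -> : T y - y = - L (T y) by rewrite -{2}[y]TS opprD addrA subrr sub0r.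
  rewrite normrN (le_trans (Lq _))//.
  rewrite (@le_trans _ _ (q * 2))//; last by lra.
  by apply: ler_wpM2l; [exact: ltW|have := T2 y; lra].
- (* [T @` E] is the preimage of [E] under [id + L], and [E] is the common kernel
     of the [h n]. *)
  have -> : T @` E = \bigcap_n [set y | h n (c0_trunc (N n) y) = 0].
    apply/seteqP; split=> [_ [z Ez <-] n _ /=|y hy].
      rewrite -hL TS; move: n; exact/hf/fE.
    exists (y + L y); last exact: ST.
    by apply/fE/hf => n; rewrite hL; exact: hy.
  apply: closed_bigI => n _.
  exact: pointwise_closed_trunc.
Qed.
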